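(* Let $\mathcal{M}$ be the mode theory with two modes $n,m$ and a single non-identity modality $\mu:n\to m$. There exists a model of intensional $\mathsf{MTT}$ over $\mathcal{M}$ in which the canonical map $$(\mu\mid x,y:A)\to \mathsf{Id}_{\langle\mu\mid A\rangle}(\mathsf{mod}_\mu(x),\mathsf{mod}_\mu(y))\to\langle\mu\mid\mathsf{Id}_A(x,y)\rangle$$ is not invertible.
   Context: Intensional $\mathsf{MTT}$ over a mode theory is the multimodal dependent type theory with locked contexts $\Gamma.\{\mu\}$, modally annotated context extension $\Gamma.(\mu\mid A)$, modal types $\langle\mu\mid A\rangle$ with introduction $\mathsf{mod}_\mu$ and let-elimination, modal dependent function types $(\mu\mid A)\to B$, and per mode dependent sums, booleans, intensional identity types $\mathsf{Id}$ and a universe. The displayed canonical map is the one defined by identity elimination sending $\mathsf{refl}$ to $\mathsf{mod}_\mu(\mathsf{refl})$; $(\mu\mid x,y:A)\to\dots$ denotes a modal dependent function type whose arguments $x,y$ are annotated with $\mu$. *)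

(* Defs.v *)
From Stdlib Require Import ProofIrrelevance Eqdep.

Set Implicit Arguments.
Unset Strict Implicit.
Unset Printing Implicit Defensive.

(** Equality in the total space of a family: the equality of the presheaf of
    all terms, used to compare terms whose types are equal but not convertible. *)
Definition tot_eq {X : Type} {F : X -> Type} {a b : X} (t : F a) (u : F b) : Prop :=
  existT F a t = existT F b u.
Notation "t =~ u" := (tot_eq t u) (at level 70, no associativity).

Definition coe_of {X : Type} {H : X -> X -> Type} (i : forall x, H x x)
  {x y : X} (e : x = y) : H x y :=
  match e in _ = y0 return H x y0 with eq_refl => i x end.

(** * Mode theories: strict 2-categories *)

Record mode_theory := {
  mode : Type;
  modality : mode -> mode -> Type;
  cell : forall n m, modality n m -> modality n m -> Type;
  mid : forall m, modality m m;
  mcomp : forall o n m, modality n m -> modality o n -> modality o m;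
  cid : forall n m (mu : modality n m), cell mu mu;
  vcomp : forall n m (mu nu rho : modality n m), cell nu rho -> cell mu nu -> cell mu rho;
  hcomp : forall o n m (mu mu' : modality n m) (nu nu' : modality o n),
    cell mu mu' -> cell nu nu' -> cell (mcomp mu nu) (mcomp mu' nu');
  mcomp_idl : forall n m (mu : modality n m), mcomp (mid m) mu = mu;
  mcomp_idr : forall n m (mu : modality n m), mcomp mu (mid n) = mu;
  mcomp_assoc : forall p o n m (mu : modality n m) (nu : modality o n) (rho : modality p o),
    mcomp mu (mcomp nu rho) = mcomp (mcomp mu nu) rho;
  vcomp_idl : forall n m (mu nu : modality n m) (al : cell mu nu), vcomp (cid nu) al = al;
  vcomp_idr : forall n m (mu nu : modality n m) (al : cell mu nu), vcomp al (cid mu) = al;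
  vcomp_assoc : forall n m (mu nu rho ka : modality n m)
    (al : cell mu nu) (be : cell nu rho) (ga : cell rho ka),
    vcomp ga (vcomp be al) = vcomp (vcomp ga be) al;
  hcomp_id : forall o n m (mu : modality n m) (nu : modality o n),
    hcomp (cid mu) (cid nu) = cid (mcomp mu nu);
  interchange : forall o n m (mu mu' mu'' : modality n m) (nu nu' nu'' : modality o n)
    (al : cell mu mu') (al' : cell mu' mu'') (be : cell nu nu') (be' : cell nu' nu''),
    hcomp (vcomp al' al) (vcomp be' be) = vcomp (hcomp al' be') (hcomp al be);
  hcomp_idl : forall n m (mu nu : modality n m) (al : cell mu nu),
    vcomp (coe_of (@cid n m) (mcomp_idl nu)) (hcomp (cid (mid m)) al)
    = vcomp al (coe_of (@cid n m) (mcomp_idl mu));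
  hcomp_idr : forall n m (mu nu : modality n m) (al : cell mu nu),
    vcomp (coe_of (@cid n m) (mcomp_idr nu)) (hcomp al (cid (mid n)))
    = vcomp al (coe_of (@cid n m) (mcomp_idr mu));
  hcomp_assoc : forall p o n m (mu mu' : modality n m) (nu nu' : modality o n)
    (rho rho' : modality p o) (al : cell mu mu') (be : cell nu nu') (ga : cell rho rho'),
    vcomp (coe_of (@cid p m) (mcomp_assoc mu' nu' rho')) (hcomp al (hcomp be ga))
    = vcomp (hcomp (hcomp al be) ga) (coe_of (@cid p m) (mcomp_assoc mu nu rho))
}.
Arguments modality {_} _ _.
Arguments cell {_ _ _} _ _.
Arguments mid {_} _.
Arguments mcomp {_ _ _ _} _ _.
Arguments cid {_ _ _} _.
Arguments vcomp {_ _ _ _ _ _} _ _.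
Arguments hcomp {_ _ _ _ _ _ _ _} _ _.
Arguments mcomp_idl {_ _ _} _.

(** * Contexts, substitutions and locks

    The data is a strict 2-functor, contravariant on modalities and on 2-cells,
    from the mode theory to categories with a chosen terminal object.
    [lock mu G] is the locked context G.{mu}. *)

Record ctx_structure (T : mode_theory) := {
  Ctx : mode T -> Type;
  Sub : forall m, Ctx m -> Ctx m -> Type;
  sid : forall m (G : Ctx m), Sub G G;
  scomp : forall m (G D E : Ctx m), Sub D E -> Sub G D -> Sub G E;
  scomp_idl : forall m (G D : Ctx m) (s : Sub G D), scomp (sid D) s = s;
  scomp_idr : forall m (G D : Ctx m) (s : Sub G D), scomp s (sid G) = s;
  scomp_assoc : forall m (G D E F : Ctx m) (s : Sub E F) (t : Sub D E) (u : Sub G D),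
    scomp s (scomp t u) = scomp (scomp s t) u;
  emp : forall m, Ctx m;
  bang : forall m (G : Ctx m), Sub G (emp m);
  bang_uniq : forall m (G : Ctx m) (s : Sub G (emp m)), s = bang G;
  lock : forall n m, modality n m -> Ctx m -> Ctx n;
  lock_sub : forall n m (mu : modality n m) (G D : Ctx m),
    Sub G D -> Sub (lock mu G) (lock mu D);
  lock_sub_id : forall n m (mu : modality n m) (G : Ctx m),
    lock_sub mu (sid G) = sid (lock mu G);
  lock_sub_comp : forall n m (mu : modality n m) (G D E : Ctx m) (s : Sub D E) (t : Sub G D),
    lock_sub mu (scomp s t) = scomp (lock_sub mu s) (lock_sub mu t);
  lock_id : forall m (G : Ctx m), lock (mid m) G = G;
  lock_comp : forall o n m (mu : modality n m) (nu : modality o n) (G : Ctx m),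
    lock (mcomp mu nu) G = lock nu (lock mu G);
  lock_id_sub : forall m (G D : Ctx m) (s : Sub G D),
    scomp s (coe_of (@sid m) (lock_id G)) = scomp (coe_of (@sid m) (lock_id D)) (lock_sub (mid m) s);
  lock_comp_sub : forall o n m (mu : modality n m) (nu : modality o n) (G D : Ctx m) (s : Sub G D),
    scomp (lock_sub nu (lock_sub mu s)) (coe_of (@sid o) (lock_comp mu nu G))
    = scomp (coe_of (@sid o) (lock_comp mu nu D)) (lock_sub (mcomp mu nu) s);
  key : forall n m (mu nu : modality n m), cell mu nu ->
    forall G : Ctx m, Sub (lock nu G) (lock mu G);
  key_nat : forall n m (mu nu : modality n m) (al : cell mu nu) (G D : Ctx m) (s : Sub G D),
    scomp (lock_sub mu s) (key al G) = scomp (key al D) (lock_sub nu s);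
  key_id : forall n m (mu : modality n m) (G : Ctx m), key (cid mu) G = sid (lock mu G);
  key_vcomp : forall n m (mu nu rho : modality n m) (al : cell mu nu) (be : cell nu rho) (G : Ctx m),
    key (vcomp be al) G = scomp (key al G) (key be G);
  key_hcomp : forall o n m (mu mu' : modality n m) (nu nu' : modality o n)
    (al : cell mu mu') (be : cell nu nu') (G : Ctx m),
    scomp (coe_of (@sid o) (lock_comp mu nu G)) (key (hcomp al be) G)
    = scomp (scomp (key be (lock mu G)) (lock_sub nu' (key al G)))
        (coe_of (@sid o) (lock_comp mu' nu' G))
}.
Arguments Ctx {_} _ _.
Arguments Sub {_ _ _} _ _.
Arguments sid {_ _ _} _.
Arguments scomp {_ _ _ _ _ _} _ _.
Arguments emp {_} _ _.
Arguments lock {_ _ _ _} _ _.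
Arguments lock_sub {_ _ _ _} _ {_ _} _.
Arguments lock_id {_ _ _} _.
Arguments lock_comp {_ _ _ _ _} _ _ _.
Notation "s ∘ t" := (scomp s t) (at level 40, left associativity).

Definition coe {T} {C : ctx_structure T} {m} {G D : Ctx C m} (e : G = D) : Sub G D :=
  coe_of (@sid T C m) e.

(** * Types, terms and modal context extension

    [ext mu A] is G.(mu | A), and [spair] exhibits it as the representing object
    of pairs of a substitution s and a term of A[s.{mu}] in the locked context. *)

Record modal_cwf (T : mode_theory) := {
  ctxs :> ctx_structure T;
  Ty : forall m, Ctx ctxs m -> Type;
  tysub : forall m (G D : Ctx ctxs m), Ty D -> Sub G D -> Ty G;
  tysub_id : forall m (G : Ctx ctxs m) (A : Ty G), tysub A (sid G) = A;
  tysub_comp : forall m (G D E : Ctx ctxs m) (A : Ty E) (s : Sub D E) (t : Sub G D),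
    tysub A (s ∘ t) = tysub (tysub A s) t;
  Tm : forall m (G : Ctx ctxs m), Ty G -> Type;
  tmsub : forall m (G D : Ctx ctxs m) (A : Ty D), Tm A -> forall s : Sub G D, Tm (tysub A s);
  tmsub_id : forall m (G : Ctx ctxs m) (A : Ty G) (a : Tm A), tmsub a (sid G) =~ a;
  tmsub_comp : forall m (G D E : Ctx ctxs m) (A : Ty E) (a : Tm A) (s : Sub D E) (t : Sub G D),
    tmsub a (s ∘ t) =~ tmsub (tmsub a s) t;
  ext : forall n m (mu : modality n m) (G : Ctx ctxs m), Ty (lock mu G) -> Ctx ctxs m;
  wk : forall n m (mu : modality n m) (G : Ctx ctxs m) (A : Ty (lock mu G)), Sub (ext A) G;
  var : forall n m (mu : modality n m) (G : Ctx ctxs m) (A : Ty (lock mu G)),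
    Tm (tysub A (lock_sub mu (wk A)));
  spair : forall n m (mu : modality n m) (G D : Ctx ctxs m) (A : Ty (lock mu D)) (s : Sub G D),
    Tm (tysub A (lock_sub mu s)) -> Sub G (ext A);
  wk_spair : forall n m (mu : modality n m) (G D : Ctx ctxs m) (A : Ty (lock mu D)) (s : Sub G D)
    (a : Tm (tysub A (lock_sub mu s))), wk A ∘ spair a = s;
  var_spair : forall n m (mu : modality n m) (G D : Ctx ctxs m) (A : Ty (lock mu D)) (s : Sub G D)
    (a : Tm (tysub A (lock_sub mu s))), tmsub (var A) (lock_sub mu (spair a)) =~ a;
  spair_eta : forall n m (mu : modality n m) (G D : Ctx ctxs m) (A : Ty (lock mu D))
    (s : Sub G (ext A)) (a : Tm (tysub A (lock_sub mu (wk A ∘ s)))),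
    a =~ tmsub (var A) (lock_sub mu s) -> spair a = s
}.
Arguments Ty {_ _ _} _.
Arguments tysub {_ _ _ _ _} _ _.
Arguments Tm {_ _ _ _} _.
Arguments tmsub {_ _ _ _ _ _} _ _.
Arguments ext {_ _ _ _} _ {_} _.
Arguments wk {_ _ _ _ _ _} _.
Arguments var {_ _ _ _ _ _} _.
Arguments spair {_ _ _ _} _ {_ _} _ _ _.
Notation "A [ s ]T" := (tysub A s) (at level 8, left associativity, format "A [ s ]T").
Notation "a [ s ]t" := (tmsub a s) (at level 8, left associativity, format "a [ s ]t").

Unset Implicit Arguments.

Section Derived.
Context {T : mode_theory} {C : modal_cwf T}.

Definition cast {m} {G : Ctx C m} {A B : Ty G} (e : A = B) (a : Tm A) : Tm B :=
  match e in _ = B0 return Tm B0 with eq_refl => a end.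

Lemma cast_tot {m} {G : Ctx C m} {A B : Ty G} (e : A = B) (a : Tm A) : cast e a =~ a.
Proof. destruct e; reflexivity. Qed.

Lemma coe_inv {m} {G D : Ctx C m} (e : G = D) : coe e ∘ coe (eq_sym e) = sid D.
Proof. destruct e; cbn. apply scomp_idl. Defined.

Lemma coe_inv' {m} {G D : Ctx C m} (e : G = D) : coe (eq_sym e) ∘ coe e = sid G.
Proof. destruct e; cbn. apply scomp_idl. Defined.

Lemma lift_ty {n m} {mu : modality n m} {G D E : Ctx C m} (s : Sub G D) (t : Sub E G)
  {A : Ty (lock mu D)} {A' : Ty (lock mu G)} (e : A' = A[lock_sub mu s]T) :
  A'[lock_sub mu t]T = A[lock_sub mu (s ∘ t)]T.
Proof. rewrite e, lock_sub_comp, tysub_comp. reflexivity. Defined.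

Definition lift {n m} (mu : modality n m) {G D : Ctx C m} (s : Sub G D)
  {A : Ty (lock mu D)} {A' : Ty (lock mu G)} (e : A' = A[lock_sub mu s]T) :
  Sub (ext mu A') (ext mu A) :=
  spair mu A (s ∘ wk A') (cast (lift_ty s (wk A') e) (var A')).

(** Ordinary context extension G.A is G.(1 | A), using G.{1} = G. *)

Definition lock1 {m} {G : Ctx C m} (A : Ty G) : Ty (lock (mid m) G) := A[coe (lock_id G)]T.

Lemma lock1_ty {m} {G D : Ctx C m} (A : Ty D) (s : Sub G D) :
  lock1 A[s]T = (lock1 A)[lock_sub (mid m) s]T.
Proof.
unfold lock1. rewrite <- !tysub_comp. apply f_equal. apply lock_id_sub.
Defined.

Lemma unlock1_ty {m} {G D : Ctx C m} (A : Ty D) (s : Sub G D) :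
  (lock1 A)[lock_sub (mid m) s]T[coe (eq_sym (lock_id G))]T = A[s]T.
Proof.
rewrite <- lock1_ty. unfold lock1. rewrite <- tysub_comp, coe_inv. apply tysub_id.
Defined.

Definition ext1 {m} {G : Ctx C m} (A : Ty G) : Ctx C m := ext (mid m) (lock1 A).

Definition wk1 {m} {G : Ctx C m} (A : Ty G) : Sub (ext1 A) G := wk (lock1 A).

Definition var1 {m} {G : Ctx C m} (A : Ty G) : Tm A[wk1 A]T :=
  cast (unlock1_ty A (wk1 A)) (var (lock1 A))[coe (eq_sym (lock_id (ext1 A)))]t.

Definition spair1 {m} {G D : Ctx C m} (A : Ty D) (s : Sub G D) (a : Tm A[s]T) :
  Sub G (ext1 A) :=
  spair (mid m) (lock1 A) s (cast (lock1_ty A s) a[coe (lock_id G)]t).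

Definition inst {m} {G : Ctx C m} {A : Ty G} (a : Tm A) : Sub G (ext1 A) :=
  spair1 A (sid G) (cast (eq_sym (tysub_id A)) a).

Lemma lift1_ty {m} {G D : Ctx C m} (s : Sub G D) {A : Ty D} {A' : Ty G} (e : A' = A[s]T) :
  lock1 A' = (lock1 A)[lock_sub (mid m) s]T.
Proof. rewrite e. apply lock1_ty. Defined.

Definition lift1 {m} {G D : Ctx C m} (s : Sub G D) {A : Ty D} {A' : Ty G} (e : A' = A[s]T) :
  Sub (ext1 A') (ext1 A) :=
  lift (mid m) s (lift1_ty s e).

(** The type A over G.{nu}.{mu} seen over G.{nu o mu}. *)

Definition merge {o n m} {nu : modality n m} {mu : modality o n} {G : Ctx C m}
  (A : Ty (lock mu (lock nu G))) : Ty (lock (mcomp nu mu) G) :=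
  A[coe (lock_comp nu mu G)]T.

Lemma merge_ty {o n m} {nu : modality n m} {mu : modality o n} {G D : Ctx C m}
  (A : Ty (lock mu (lock nu D))) (s : Sub G D) :
  merge A[lock_sub mu (lock_sub nu s)]T = (merge A)[lock_sub (mcomp nu mu) s]T.
Proof.
unfold merge. rewrite <- !tysub_comp. apply f_equal. apply lock_comp_sub.
Defined.

Lemma split_ty {o n m} {nu : modality n m} {mu : modality o n} {G D : Ctx C m}
  (A : Ty (lock mu (lock nu D))) (s : Sub G D) :
  (merge A)[lock_sub (mcomp nu mu) s]T[coe (eq_sym (lock_comp nu mu G))]T
  = A[lock_sub mu (lock_sub nu s)]T.
Proof.
rewrite <- merge_ty. unfold merge. rewrite <- tysub_comp, coe_inv. apply tysub_id.
Defined.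

Definition var_split {o n m} {nu : modality n m} {mu : modality o n} {G : Ctx C m}
  (A : Ty (lock mu (lock nu G))) :
  Tm A[lock_sub mu (lock_sub nu (wk (merge A)))]T :=
  cast (split_ty A (wk (merge A))) (var (merge A))[coe (eq_sym (lock_comp nu mu (ext _ (merge A))))]t.

Lemma tot_trans {X : Type} {F : X -> Type} {a b c : X} {t : F a} {u : F b} {v : F c} :
  t =~ u -> u =~ v -> t =~ v.
Proof. unfold tot_eq. apply eq_trans. Qed.

Lemma tot_sym {X : Type} {F : X -> Type} {a b : X} {t : F a} {u : F b} : t =~ u -> u =~ t.
Proof. unfold tot_eq. apply eq_sym. Qed.

Lemma tot_elim {X : Type} {F : X -> Type} (P : forall x, F x -> Prop) {a b : X} {t : F a} {u : F b} :
  t =~ u -> P a t -> P b u.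
Proof.
intros h p.
exact (@eq_ind _ (existT F a t) (fun z => P (projT1 z) (projT2 z)) p (existT F b u) h).
Qed.

Lemma tot_eq_eq {X : Type} {F : X -> Type} {a : X} {t u : F a} : t =~ u -> t = u.
Proof. apply inj_pair2. Qed.

Lemma tot_ty {X : Type} {F : X -> Type} {a b : X} {t : F a} {u : F b} : t =~ u -> a = b.
Proof. intros h. exact (f_equal (@projT1 X F) h). Qed.

Lemma tmsub_tot {m} {G D : Ctx C m} {A B : Ty D} {a : Tm A} {b : Tm B} (s : Sub G D) :
  a =~ b -> a[s]t =~ b[s]t.
Proof.
intros h. apply (tot_elim (fun B (b : Tm B) => a[s]t =~ b[s]t) h). reflexivity.
Qed.

Lemma tmsub_eq {m} {G D : Ctx C m} {A : Ty D} (a : Tm A) {s t : Sub G D} :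
  s = t -> a[s]t =~ a[t]t.
Proof. intros []. reflexivity. Qed.

Lemma cast_sub {m} {G D : Ctx C m} {A B : Ty D} (e : A = B) (a : Tm A) (s : Sub G D) :
  (cast e a)[s]t =~ a[s]t.
Proof. apply tmsub_tot, cast_tot. Qed.

Lemma spair_tot {n m} {mu : modality n m} {G D : Ctx C m} {A : Ty (lock mu D)} {s t : Sub G D}
  {a : Tm A[lock_sub mu s]T} {b : Tm A[lock_sub mu t]T} :
  s = t -> a =~ b -> spair mu A s a = spair mu A t b.
Proof. intros e h. subst t. apply tot_eq_eq in h. subst b. reflexivity. Qed.

Lemma spair_ext {n m} {mu : modality n m} {G D : Ctx C m} {A : Ty (lock mu D)}
  {s t : Sub G (ext mu A)} :
  wk A ∘ s = wk A ∘ t -> (var A)[lock_sub mu s]t =~ (var A)[lock_sub mu t]t -> s = t.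
Proof.
intros e h.
assert (E : forall r : Sub G (ext mu A),
  A[lock_sub mu (wk A)]T[lock_sub mu r]T = A[lock_sub mu (wk A ∘ r)]T).
{ intros r. rewrite lock_sub_comp, tysub_comp. reflexivity. }
rewrite <- (@spair_eta _ _ _ _ _ _ _ _ s (cast (E s) (var A)[lock_sub mu s]t)) by apply cast_tot.
rewrite <- (@spair_eta _ _ _ _ _ _ _ _ t (cast (E t) (var A)[lock_sub mu t]t)) by apply cast_tot.
apply spair_tot; [exact e|].
eapply tot_trans; [apply cast_tot|]. eapply tot_trans; [exact h|]. apply tot_sym, cast_tot.
Qed.

Lemma wk1_spair1 {m} {G D : Ctx C m} {A : Ty D} {s : Sub G D} (a : Tm A[s]T) :
  wk1 A ∘ spair1 A s a = s.
Proof. apply wk_spair. Qed.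

Lemma unlock_nat {m} {G D : Ctx C m} (s : Sub G D) :
  coe (eq_sym (lock_id D)) ∘ s = lock_sub (mid m) s ∘ coe (eq_sym (lock_id G)).
Proof.
transitivity (coe (eq_sym (lock_id D)) ∘ (s ∘ sid G)).
{ rewrite scomp_idr. reflexivity. }
rewrite <- (coe_inv (lock_id G)).
rewrite (scomp_assoc s). unfold coe at 2. rewrite lock_id_sub. fold (coe (lock_id D)).
rewrite <- (scomp_assoc (coe (lock_id D))), scomp_assoc, coe_inv', scomp_idl. reflexivity.
Qed.

Lemma var1_sub {m} {G D : Ctx C m} {A : Ty D} (s : Sub G (ext1 A)) :
  (var1 A)[s]t =~ (var (lock1 A))[lock_sub (mid m) s]t[coe (eq_sym (lock_id G))]t.
Proof.
unfold var1. eapply tot_trans; [apply cast_sub|].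
eapply tot_trans; [apply tot_sym, tmsub_comp|].
eapply tot_trans; [apply tmsub_eq, unlock_nat|]. apply tmsub_comp.
Qed.

Lemma var1_spair1 {m} {G D : Ctx C m} {A : Ty D} {s : Sub G D} (a : Tm A[s]T) :
  (var1 A)[spair1 A s a]t =~ a.
Proof.
eapply tot_trans; [apply var1_sub|].
eapply tot_trans; [eapply tmsub_tot; unfold spair1; apply var_spair|].
eapply tot_trans; [apply cast_sub|].
eapply tot_trans; [apply tot_sym, tmsub_comp|].
eapply tot_trans; [apply tmsub_eq, coe_inv|]. apply tmsub_id.
Qed.

Lemma wk1_inst {m} {G : Ctx C m} {A : Ty G} (a : Tm A) : wk1 A ∘ inst a = sid G.
Proof. apply wk1_spair1. Qed.

Lemma var1_inst {m} {G : Ctx C m} {A : Ty G} (a : Tm A) : (var1 A)[inst a]t =~ a.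
Proof. eapply tot_trans; [apply var1_spair1|apply cast_tot]. Qed.

Lemma wk_lift {n m} {mu : modality n m} {G D : Ctx C m} (s : Sub G D)
  {A : Ty (lock mu D)} {A' : Ty (lock mu G)} (e : A' = A[lock_sub mu s]T) :
  wk A ∘ lift mu s e = s ∘ wk A'.
Proof. apply wk_spair. Qed.

Lemma var_lift {n m} {mu : modality n m} {G D : Ctx C m} (s : Sub G D)
  {A : Ty (lock mu D)} {A' : Ty (lock mu G)} (e : A' = A[lock_sub mu s]T) :
  (var A)[lock_sub mu (lift mu s e)]t =~ var A'.
Proof. eapply tot_trans; [apply var_spair|apply cast_tot]. Qed.

Lemma wk1_lift1 {m} {G D : Ctx C m} (s : Sub G D) {A : Ty D} {A' : Ty G} (e : A' = A[s]T) :
  wk1 A ∘ lift1 s e = s ∘ wk1 A'.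
Proof. apply wk_lift. Qed.

Lemma var1_lift1 {m} {G D : Ctx C m} (s : Sub G D) {A : Ty D} {A' : Ty G} (e : A' = A[s]T) :
  (var1 A)[lift1 s e]t =~ var1 A'.
Proof.
eapply tot_trans; [apply var1_sub|].
eapply tot_trans; [eapply tmsub_tot; apply var_lift|].
apply tot_sym, cast_tot.
Qed.

Lemma wk1_inst_tm {m} {G : Ctx C m} {A B : Ty G} (a : Tm A) (b : Tm B) :
  b[wk1 A]t[inst a]t =~ b.
Proof.
eapply tot_trans; [apply tot_sym, tmsub_comp|].
eapply tot_trans; [apply tmsub_eq, wk1_inst|]. apply tmsub_id.
Qed.

End Derived.

Set Implicit Arguments.

(** * Connectives

    Eliminators are given in generic form (on the last variable of the context);
    elimination of an arbitrary term is recovered by substitution. In the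
    naturality laws of an eliminator the primed premises are the substituted ones. *)

(** Modal dependent function types (mu | A) -> B, with beta and eta. *)
Record pi_structure {T} (C : modal_cwf T) := {
  Pi : forall n m (mu : modality n m) (G : Ctx C m) (A : Ty (lock mu G)), Ty (ext mu A) -> Ty G;
  Pi_sub : forall n m (mu : modality n m) (G D : Ctx C m) (A : Ty (lock mu D)) (B : Ty (ext mu A))
    (s : Sub G D), (Pi B)[s]T = Pi B[lift mu s (eq_refl A[lock_sub mu s]T)]T;
  lam : forall n m (mu : modality n m) (G : Ctx C m) (A : Ty (lock mu G)) (B : Ty (ext mu A)),
    Tm B -> Tm (Pi B);
  unlam : forall n m (mu : modality n m) (G : Ctx C m) (A : Ty (lock mu G)) (B : Ty (ext mu A)),
    Tm (Pi B) -> Tm B;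
  unlam_lam : forall n m (mu : modality n m) (G : Ctx C m) (A : Ty (lock mu G))
    (B : Ty (ext mu A)) (b : Tm B), unlam (lam b) = b;
  lam_unlam : forall n m (mu : modality n m) (G : Ctx C m) (A : Ty (lock mu G))
    (B : Ty (ext mu A)) (f : Tm (Pi B)), lam (unlam f) = f;
  lam_sub : forall n m (mu : modality n m) (G D : Ctx C m) (A : Ty (lock mu D)) (B : Ty (ext mu A))
    (b : Tm B) (s : Sub G D),
    (lam b)[s]t =~ lam b[lift mu s (eq_refl A[lock_sub mu s]T)]t
}.
Arguments Pi {_ _} _ {_ _} _ {_} _ _.
Arguments lam {_ _} _ {_ _} _ {_ _ _} _.
Arguments unlam {_ _} _ {_ _} _ {_ _ _} _.

(** Modal types <mu | A>: introduction mod, and let-elimination for every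
    framing modality nu. There is no eta law. *)
Record mod_formation {T} (C : modal_cwf T) := {
  Mod : forall n m (mu : modality n m) (G : Ctx C m), Ty (lock mu G) -> Ty G;
  Mod_sub : forall n m (mu : modality n m) (G D : Ctx C m) (A : Ty (lock mu D)) (s : Sub G D),
    (Mod A)[s]T = Mod A[lock_sub mu s]T;
  mod : forall n m (mu : modality n m) (G : Ctx C m) (A : Ty (lock mu G)), Tm A -> Tm (Mod A);
  mod_sub : forall n m (mu : modality n m) (G D : Ctx C m) (A : Ty (lock mu D)) (a : Tm A)
    (s : Sub G D), (mod a)[s]t =~ mod a[lock_sub mu s]t
}.
Arguments Mod {_ _} _ {_ _} _ {_} _.
Arguments Mod_sub {_ _} _ {_ _} _ {_ _} _ _.
Arguments mod {_ _} _ {_ _} _ {_ _} _.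

Unset Implicit Arguments.

(** The substitution G.(nu o mu | x : A) -> G.(nu | <mu | A>) with last component mod x. *)
Definition mod_var {T} {C : modal_cwf T} (F : mod_formation C) {o n m}
  (nu : modality n m) (mu : modality o n) {G : Ctx C m} (A : Ty (lock mu (lock nu G))) :
  Sub (ext (mcomp nu mu) (merge A)) (ext nu (Mod F mu A)) :=
  spair nu (Mod F mu A) (wk (merge A))
    (cast (eq_sym (Mod_sub F mu A _)) (mod F mu (var_split A))).

Set Implicit Arguments.

Record mod_structure {T} (C : modal_cwf T) := {
  mod_form :> mod_formation C;
  letmod : forall o n m (nu : modality n m) (mu : modality o n) (G : Ctx C m)
    (A : Ty (lock mu (lock nu G))) (B : Ty (ext nu (Mod mod_form mu A))),
    Tm B[mod_var mod_form nu mu A]T -> Tm B;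
  letmod_beta : forall o n m (nu : modality n m) (mu : modality o n) (G : Ctx C m)
    (A : Ty (lock mu (lock nu G))) (B : Ty (ext nu (Mod mod_form mu A)))
    (b : Tm B[mod_var mod_form nu mu A]T),
    (letmod b)[mod_var mod_form nu mu A]t = b;
  letmod_sub : forall o n m (nu : modality n m) (mu : modality o n) (G D : Ctx C m)
    (A : Ty (lock mu (lock nu D))) (B : Ty (ext nu (Mod mod_form mu A)))
    (b : Tm B[mod_var mod_form nu mu A]T) (s : Sub G D),
    let A' := A[lock_sub mu (lock_sub nu s)]T in
    let B' := B[lift nu s (eq_sym (Mod_sub mod_form mu A (lock_sub nu s)))]T in
    forall b' : Tm B'[mod_var mod_form nu mu A']T,
    b' =~ b[lift (mcomp nu mu) s (merge_ty A s)]t ->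
    (letmod b)[lift nu s (eq_sym (Mod_sub mod_form mu A (lock_sub nu s)))]t =~ letmod b'
}.
Arguments letmod {_ _} _ {_ _ _} _ _ {_ _} _ _.

Record sig_structure {T} (C : modal_cwf T) := {
  Sig : forall m (G : Ctx C m) (A : Ty G), Ty (ext1 A) -> Ty G;
  Sig_sub : forall m (G D : Ctx C m) (A : Ty D) (B : Ty (ext1 A)) (s : Sub G D),
    (Sig B)[s]T = Sig B[lift1 s (eq_refl A[s]T)]T;
  spr : forall m (G : Ctx C m) (A : Ty G) (B : Ty (ext1 A)) (a : Tm A),
    Tm B[inst a]T -> Tm (Sig B);
  pr1 : forall m (G : Ctx C m) (A : Ty G) (B : Ty (ext1 A)), Tm (Sig B) -> Tm A;
  pr2 : forall m (G : Ctx C m) (A : Ty G) (B : Ty (ext1 A)) (p : Tm (Sig B)), Tm B[inst (pr1 p)]T;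
  pr1_spr : forall m (G : Ctx C m) (A : Ty G) (B : Ty (ext1 A)) (a : Tm A) (b : Tm B[inst a]T),
    pr1 (spr b) = a;
  pr2_spr : forall m (G : Ctx C m) (A : Ty G) (B : Ty (ext1 A)) (a : Tm A) (b : Tm B[inst a]T),
    pr2 (spr b) =~ b;
  spr_eta : forall m (G : Ctx C m) (A : Ty G) (B : Ty (ext1 A)) (p : Tm (Sig B)),
    spr (pr2 p) = p;
  pr1_sub : forall m (G D : Ctx C m) (A : Ty D) (B : Ty (ext1 A)) (p : Tm (Sig B)) (s : Sub G D),
    (pr1 p)[s]t = pr1 (cast (Sig_sub B s) p[s]t);
  pr2_sub : forall m (G D : Ctx C m) (A : Ty D) (B : Ty (ext1 A)) (p : Tm (Sig B)) (s : Sub G D),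
    (pr2 p)[s]t =~ pr2 (cast (Sig_sub B s) p[s]t)
}.
Arguments Sig {_ _} _ {_ _ _} _.

Record bool_structure {T} (C : modal_cwf T) := {
  Bool : forall m (G : Ctx C m), Ty G;
  Bool_sub : forall m (G D : Ctx C m) (s : Sub G D), (Bool D)[s]T = Bool G;
  btrue : forall m (G : Ctx C m), Tm (Bool G);
  bfalse : forall m (G : Ctx C m), Tm (Bool G);
  btrue_sub : forall m (G D : Ctx C m) (s : Sub G D), (btrue D)[s]t =~ btrue G;
  bfalse_sub : forall m (G D : Ctx C m) (s : Sub G D), (bfalse D)[s]t =~ bfalse G;
  belim : forall m (G : Ctx C m) (B : Ty (ext1 (Bool G))),
    Tm B[inst (btrue G)]T -> Tm B[inst (bfalse G)]T -> Tm B;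
  belim_true : forall m (G : Ctx C m) (B : Ty (ext1 (Bool G)))
    (b : Tm B[inst (btrue G)]T) (c : Tm B[inst (bfalse G)]T), (belim b c)[inst (btrue G)]t = b;
  belim_false : forall m (G : Ctx C m) (B : Ty (ext1 (Bool G)))
    (b : Tm B[inst (btrue G)]T) (c : Tm B[inst (bfalse G)]T), (belim b c)[inst (bfalse G)]t = c;
  belim_sub : forall m (G D : Ctx C m) (B : Ty (ext1 (Bool D)))
    (b : Tm B[inst (btrue D)]T) (c : Tm B[inst (bfalse D)]T) (s : Sub G D),
    let B' := B[lift1 s (eq_sym (Bool_sub s))]T in
    forall (b' : Tm B'[inst (btrue G)]T) (c' : Tm B'[inst (bfalse G)]T),
    b' =~ b[s]t -> c' =~ c[s]t ->
    (belim b c)[lift1 s (eq_sym (Bool_sub s))]t =~ belim b' c'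
}.
Arguments Bool {_ _} _ {_} _.

Record id_formation {T} (C : modal_cwf T) := {
  Id : forall m (G : Ctx C m) (A : Ty G), Tm A -> Tm A -> Ty G;
  Id_sub : forall m (G D : Ctx C m) (A : Ty D) (a b : Tm A) (s : Sub G D),
    (Id a b)[s]T = Id a[s]t b[s]t;
  rfl : forall m (G : Ctx C m) (A : Ty G) (a : Tm A), Tm (Id a a);
  rfl_sub : forall m (G D : Ctx C m) (A : Ty D) (a : Tm A) (s : Sub G D),
    (rfl a)[s]t =~ rfl a[s]t
}.
Arguments Id {_ _} _ {_ _ _} _ _.
Arguments Id_sub {_ _} _ {_ _ _ _} _ _ _.
Arguments rfl {_ _} _ {_ _ _} _.

Unset Implicit Arguments.

Section IdDerived.
Context {T : mode_theory} {C : modal_cwf T} (F : id_formation C).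

Lemma Id_tot {m} {G : Ctx C m} {A A' : Ty G} {a b : Tm A} {a' b' : Tm A'} :
  a =~ a' -> b =~ b' -> Id F a b = Id F a' b'.
Proof.
intros h. revert b'.
apply (tot_elim (fun A' (a' : Tm A') => forall b' : Tm A', b =~ b' -> Id F a b = Id F a' b') h).
intros b' k. apply tot_eq_eq in k. rewrite k. reflexivity.
Qed.

Lemma rfl_tot {m} {G : Ctx C m} {A A' : Ty G} {a : Tm A} {a' : Tm A'} :
  a =~ a' -> rfl F a =~ rfl F a'.
Proof.
intros h. apply (tot_elim (fun A' (a' : Tm A') => rfl F a =~ rfl F a') h). reflexivity.
Qed.

(** The type Id(a, x) over G.(x : A). *)
Definition path_from {m} {G : Ctx C m} {A : Ty G} (a : Tm A) : Ty (ext1 A) :=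
  Id F a[wk1 A]t (var1 A).

Lemma path_from_inst {m} {G : Ctx C m} {A : Ty G} (a : Tm A) :
  Id F a a = (path_from a)[inst a]T.
Proof.
unfold path_from. rewrite Id_sub.
apply Id_tot; apply tot_sym; [apply wk1_inst_tm|apply var1_inst].
Qed.

Definition rfl_pt {m} {G : Ctx C m} {A : Ty G} (a : Tm A) : Sub G (ext1 (path_from a)) :=
  spair1 (path_from a) (inst a) (cast (path_from_inst a) (rfl F a)).

Lemma path_from_lift {m} {G D : Ctx C m} {A : Ty D} (a : Tm A) (s : Sub G D) :
  path_from a[s]t = (path_from a)[lift1 s (eq_refl A[s]T)]T.
Proof.
unfold path_from. rewrite Id_sub. apply Id_tot; apply tot_sym.
- eapply tot_trans; [apply tot_sym, tmsub_comp|].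
  eapply tot_trans; [apply tmsub_eq, wk1_lift1|]. apply tmsub_comp.
- apply var1_lift1.
Qed.

Definition path_lift {m} {G D : Ctx C m} {A : Ty D} (a : Tm A) (s : Sub G D) :
  Sub (ext1 (path_from a[s]t)) (ext1 (path_from a)) :=
  lift1 (lift1 s (eq_refl A[s]T)) (path_from_lift a s).

End IdDerived.

Set Implicit Arguments.

(** The eliminator [J] is based path induction: its motive ranges over
    G.(x : A).(p : Id(a, x)). *)
Record id_structure {T} (C : modal_cwf T) := {
  id_form :> id_formation C;
  J : forall m (G : Ctx C m) (A : Ty G) (a : Tm A) (B : Ty (ext1 (path_from id_form a))),
    Tm B[rfl_pt id_form a]T -> Tm B;
  J_beta : forall m (G : Ctx C m) (A : Ty G) (a : Tm A) (B : Ty (ext1 (path_from id_form a)))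
    (b : Tm B[rfl_pt id_form a]T), (J b)[rfl_pt id_form a]t = b;
  J_sub : forall m (G D : Ctx C m) (A : Ty D) (a : Tm A) (B : Ty (ext1 (path_from id_form a)))
    (b : Tm B[rfl_pt id_form a]T) (s : Sub G D),
    let B' := B[path_lift id_form a s]T in
    forall b' : Tm B'[rfl_pt id_form a[s]t]T,
    b' =~ b[s]t -> (J b)[path_lift id_form a s]t =~ J b'
}.
Arguments J {_ _} _ {_ _ _} _ _ _.

Record univ_formation {T} (C : modal_cwf T) := {
  U : forall m (G : Ctx C m), Ty G;
  U_sub : forall m (G D : Ctx C m) (s : Sub G D), (U D)[s]T = U G;
  El : forall m (G : Ctx C m), Tm (U G) -> Ty G;
  El_sub : forall m (G D : Ctx C m) (c : Tm (U D)) (s : Sub G D),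
    (El c)[s]T = El (cast (U_sub s) c[s]t)
}.
Arguments U {_ _} _ {_} _.
Arguments U_sub {_ _} _ {_ _ _} _.
Arguments El {_ _} _ {_ _} _.
Arguments El_sub {_ _} _ {_ _ _} _ _.

Unset Implicit Arguments.

Definition csub {T} {C : modal_cwf T} (V : univ_formation C) {m} {G D : Ctx C m}
  (c : Tm (U V D)) (s : Sub G D) : Tm (U V G) :=
  cast (U_sub V s) c[s]t.

Set Implicit Arguments.

(** The universes are closed under all connectives; the codes and their
    decoding are strictly stable under substitution. *)
Record univ_structure {T} (C : modal_cwf T) (P : pi_structure C) (M : mod_structure C)
  (S : sig_structure C) (B : bool_structure C) (I : id_structure C) := {
  univ_form :> univ_formation C;
  cPi : forall n m (mu : modality n m) (G : Ctx C m) (a : Tm (U univ_form (lock mu G))),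
    Tm (U univ_form (ext mu (El univ_form a))) -> Tm (U univ_form G);
  cMod : forall n m (mu : modality n m) (G : Ctx C m),
    Tm (U univ_form (lock mu G)) -> Tm (U univ_form G);
  cSig : forall m (G : Ctx C m) (a : Tm (U univ_form G)),
    Tm (U univ_form (ext1 (El univ_form a))) -> Tm (U univ_form G);
  cBool : forall m (G : Ctx C m), Tm (U univ_form G);
  cId : forall m (G : Ctx C m) (a : Tm (U univ_form G)),
    Tm (El univ_form a) -> Tm (El univ_form a) -> Tm (U univ_form G);
  El_cPi : forall n m (mu : modality n m) (G : Ctx C m) (a : Tm (U univ_form (lock mu G)))
    (b : Tm (U univ_form (ext mu (El univ_form a)))),
    El univ_form (cPi b) = Pi P mu (El univ_form a) (El univ_form b);
  El_cMod : forall n m (mu : modality n m) (G : Ctx C m) (a : Tm (U univ_form (lock mu G))),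
    El univ_form (cMod a) = Mod M mu (El univ_form a);
  El_cSig : forall m (G : Ctx C m) (a : Tm (U univ_form G))
    (b : Tm (U univ_form (ext1 (El univ_form a)))),
    El univ_form (cSig b) = Sig S (El univ_form b);
  El_cBool : forall m (G : Ctx C m), El univ_form (cBool G) = Bool B G;
  El_cId : forall m (G : Ctx C m) (a : Tm (U univ_form G)) (x y : Tm (El univ_form a)),
    El univ_form (cId x y) = Id I x y;
  cPi_sub : forall n m (mu : modality n m) (G D : Ctx C m) (a : Tm (U univ_form (lock mu D)))
    (b : Tm (U univ_form (ext mu (El univ_form a)))) (s : Sub G D),
    csub univ_form (cPi b) s
    = cPi (csub univ_form b (lift mu s (eq_sym (El_sub univ_form a (lock_sub mu s)))));
  cMod_sub : forall n m (mu : modality n m) (G D : Ctx C m) (a : Tm (U univ_form (lock mu D)))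
    (s : Sub G D), csub univ_form (cMod a) s = cMod (csub univ_form a (lock_sub mu s));
  cSig_sub : forall m (G D : Ctx C m) (a : Tm (U univ_form D))
    (b : Tm (U univ_form (ext1 (El univ_form a)))) (s : Sub G D),
    csub univ_form (cSig b) s
    = cSig (csub univ_form b (lift1 s (eq_sym (El_sub univ_form a s))));
  cBool_sub : forall m (G D : Ctx C m) (s : Sub G D), csub univ_form (cBool D) s = cBool G;
  cId_sub : forall m (G D : Ctx C m) (a : Tm (U univ_form D)) (x y : Tm (El univ_form a))
    (s : Sub G D),
    csub univ_form (cId x y) s
    = cId (cast (El_sub univ_form a s) x[s]t) (cast (El_sub univ_form a s) y[s]t)
}.
Arguments cMod {_ _ _ _ _ _ _} _ {_ _} _ {_} _.
Arguments cId {_ _ _ _ _ _ _} _ {_ _ _} _ _.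

Record MTT_model (T : mode_theory) := {
  cwf :> modal_cwf T;
  model_pi : pi_structure cwf;
  model_mod : mod_structure cwf;
  model_sig : sig_structure cwf;
  model_bool : bool_structure cwf;
  model_id : id_structure cwf;
  model_univ : univ_structure model_pi model_mod model_sig model_bool model_id
}.
Arguments model_pi {_} _.
Arguments model_mod {_} _.
Arguments model_id {_} _.
Arguments model_univ {_} _.

Unset Implicit Arguments.

Section Canonical.
Context {T : mode_theory} (M : MTT_model T).

Definition Arr {m} {G : Ctx M m} (X Y : Ty G) : Ty G :=
  Pi (model_pi M) (mid m) (lock1 X) Y[wk1 X]T.

Definition fun_apply {m} {G : Ctx M m} {X Y : Ty G} (f : Tm (Arr X Y)) : Tm Y[wk1 X]T :=
  unlam (model_pi M) (mid m) f.

Lemma after_ty {m} {G : Ctx M m} {X Y : Ty G} (Z : Ty G) (y : Tm Y[wk1 X]T) :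
  Z[wk1 Y]T[spair1 Y (wk1 X) y]T = Z[wk1 X]T.
Proof. rewrite <- tysub_comp, wk1_spair1. reflexivity. Qed.

(** g (f x) in the context G.(x : X). *)
Definition after {m} {G : Ctx M m} {X Y Z : Ty G} (g : Tm (Arr Y Z)) (f : Tm (Arr X Y)) :
  Tm Z[wk1 X]T :=
  cast (after_ty Z (fun_apply f)) (fun_apply g)[spair1 Y (wk1 X) (fun_apply f)]t.

(** Invertibility in the sense of the type theory: an inverse up to [Id]. *)
Definition invertible {m} {G : Ctx M m} {X Y : Ty G} (f : Tm (Arr X Y)) : Prop :=
  exists g : Tm (Arr Y X),
    inhabited (Tm (Id (model_id M) (after g f) (var1 X))) /\
    inhabited (Tm (Id (model_id M) (after f g) (var1 Y))).

Lemma mod_tot {n m} {mu : modality n m} {G : Ctx M m} {A B : Ty (lock mu G)}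
  {a : Tm A} {b : Tm B} :
  a =~ b -> mod (model_mod M) mu a =~ mod (model_mod M) mu b.
Proof.
intros h.
apply (tot_elim (fun B (b : Tm B) => mod (model_mod M) mu a =~ mod (model_mod M) mu b) h).
reflexivity.
Qed.

Lemma El_eq {m} {G : Ctx M m} {X : Ty G} (c : Tm (U (model_univ M) G)) (d : Tm X) (e : X = U _ G) :
  c =~ d -> El (model_univ M) c = El (model_univ M) (cast e d).
Proof.
intros h. apply f_equal, tot_eq_eq.
eapply tot_trans; [exact h|]. apply tot_sym, cast_tot.
Qed.

(** Let-elimination with framing modality 1, where G.(1 o mu | A) is replaced
    by G.(mu | A): 1 o mu = mu holds only propositionally, so the two contexts are
    compared by the substitutions [frame] and [unframe]. *)

Section LetUnframed.
Context {n m : mode T} {mu : modality n m} {G : Ctx M m} (A : Ty (lock mu G)).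

Definition under1 : Ty (lock mu (lock (mid m) G)) := A[lock_sub mu (coe (lock_id G))]T.

Lemma unframe_ty (D : Ctx M m) (s : Sub D G) :
  under1[lock_sub mu (lock_sub (mid m) s)]T[lock_sub mu (coe (eq_sym (lock_id D)))]T
  = A[lock_sub mu s]T.
Proof.
unfold under1. rewrite <- !tysub_comp, <- !lock_sub_comp.
rewrite <- unlock_nat, scomp_assoc, coe_inv, scomp_idl. reflexivity.
Qed.

Lemma frame_ty (D : Ctx M m) (s : Sub D G) :
  A[lock_sub mu s]T[lock_sub mu (coe (lock_id D))]T[coe (lock_comp (mid m) mu D)]T
  = (merge under1)[lock_sub (mcomp (mid m) mu) s]T.
Proof.
rewrite <- merge_ty. unfold under1, merge.
rewrite <- !tysub_comp, !scomp_assoc, <- !lock_sub_comp.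
unfold coe. rewrite lock_id_sub. reflexivity.
Qed.

Definition unframe : Sub (ext (mcomp (mid m) mu) (merge under1)) (ext mu A) :=
  spair mu A (wk (merge under1))
    (cast (unframe_ty _ (wk (merge under1)))
      (var_split under1)[lock_sub mu (coe (eq_sym (lock_id _)))]t).

Definition frame : Sub (ext mu A) (ext (mcomp (mid m) mu) (merge under1)) :=
  spair (mcomp (mid m) mu) (merge under1) (wk A)
    (cast (frame_ty _ (wk A))
      (var A)[lock_sub mu (coe (lock_id _))]t[coe (lock_comp (mid m) mu _)]t).

Lemma reframe_ty : lock1 (Mod (model_mod M) mu A)
  = (Mod (model_mod M) mu under1)[lock_sub (mid m) (sid G)]T.
Proof.
unfold lock1, under1. rewrite lock_sub_id, tysub_id, Mod_sub. reflexivity.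
Qed.

Definition reframe :
  Sub (ext1 (Mod (model_mod M) mu A)) (ext (mid m) (Mod (model_mod M) mu under1)) :=
  lift (mid m) (sid G) reframe_ty.

(** G.(mu | A) -> G.<mu | A>, sending x to mod x. *)
Definition mod_pt : Sub (ext mu A) (ext1 (Mod (model_mod M) mu A)) :=
  spair1 (Mod (model_mod M) mu A) (wk A)
    (cast (eq_sym (Mod_sub (model_mod M) mu A (wk A))) (mod (model_mod M) mu (var A))).

Definition let1 (c : Tm (U (model_univ M) (ext mu A))) :
  Tm (U (model_univ M) (ext1 (Mod (model_mod M) mu A))) :=
  csub (model_univ M)
    (letmod (model_mod M) (mid m) mu (A := under1) (U (model_univ M) _)
      (cast (eq_sym (U_sub (model_univ M) _)) (csub (model_univ M) c unframe)))
    reframe.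

Lemma split_nat {D : Ctx M m} (s : Sub D (ext (mcomp (mid m) mu) (merge under1))) :
  coe (eq_sym (lock_comp (mid m) mu _)) ∘ lock_sub mu (lock_sub (mid m) s)
  = lock_sub (mcomp (mid m) mu) s ∘ coe (eq_sym (lock_comp (mid m) mu D)).
Proof.
transitivity (coe (eq_sym (lock_comp (mid m) mu _))
  ∘ (lock_sub mu (lock_sub (mid m) s) ∘ sid _)).
{ rewrite scomp_idr. reflexivity. }
rewrite <- (coe_inv (lock_comp (mid m) mu D)).
rewrite (scomp_assoc (lock_sub mu _)). unfold coe at 2. rewrite lock_comp_sub.
fold (coe (lock_comp (mid m) mu (ext (mcomp (mid m) mu) (merge under1)))).
rewrite <- (scomp_assoc (coe _)), scomp_assoc, coe_inv', scomp_idl. reflexivity.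
Qed.

Lemma var_split_frame :
  (var_split under1)[lock_sub mu (lock_sub (mid m) frame)]t
  =~ (var A)[lock_sub mu (coe (lock_id _))]t.
Proof.
unfold var_split. eapply tot_trans; [apply cast_sub|].
eapply tot_trans; [apply tot_sym, tmsub_comp|].
eapply tot_trans; [apply tmsub_eq, split_nat|].
eapply tot_trans; [apply tmsub_comp|].
eapply tot_trans; [eapply tmsub_tot; unfold frame; apply var_spair|].
eapply tot_trans; [apply cast_sub|].
eapply tot_trans; [apply tot_sym, tmsub_comp|].
eapply tot_trans; [apply tmsub_eq, coe_inv|]. apply tmsub_id.
Qed.

Lemma unframe_frame : unframe ∘ frame = sid _.
Proof.
apply spair_ext.
- rewrite scomp_assoc. unfold unframe at 1. rewrite wk_spair. unfold frame.
  rewrite wk_spair, scomp_idr. reflexivity.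
- rewrite lock_sub_comp, lock_sub_id.
  eapply tot_trans; [apply tmsub_comp|].
  eapply tot_trans; [eapply tmsub_tot; unfold unframe; apply var_spair|].
  eapply tot_trans; [apply cast_sub|].
  eapply tot_trans; [apply tot_sym, tmsub_comp|].
  rewrite <- lock_sub_comp, unlock_nat, lock_sub_comp.
  eapply tot_trans; [apply tmsub_comp|].
  eapply tot_trans; [eapply tmsub_tot; apply var_split_frame|].
  eapply tot_trans; [apply tot_sym, tmsub_comp|].
  rewrite <- lock_sub_comp, coe_inv, lock_sub_id. reflexivity.
Qed.

Lemma reframe_mod_pt : reframe ∘ mod_pt = mod_var (model_mod M) (mid m) mu under1 ∘ frame.
Proof.
apply spair_ext.
- assert (E : wk (Mod (model_mod M) mu under1) ∘ reframe
      = sid G ∘ wk1 (Mod (model_mod M) mu A)) by apply wk_lift.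
  rewrite !scomp_assoc, E, scomp_idl.
  unfold mod_var at 1. rewrite wk_spair. unfold frame. rewrite wk_spair.
  apply wk1_spair1.
- rewrite !lock_sub_comp.
  eapply tot_trans; [apply tmsub_comp|].
  eapply tot_trans; [eapply tmsub_tot; apply var_lift|].
  eapply tot_trans; [apply var_spair|].
  eapply tot_trans; [apply cast_tot|].
  eapply tot_trans; [apply cast_sub|].
  eapply tot_trans; [apply mod_sub|].
  apply tot_sym.
  eapply tot_trans; [apply tmsub_comp|].
  eapply tot_trans; [eapply tmsub_tot; apply var_spair|].
  eapply tot_trans; [apply cast_sub|].
  eapply tot_trans; [apply mod_sub|].
  apply mod_tot, var_split_frame.
Qed.

Lemma csub_tot {D E : Ctx M m} (c : Tm (U (model_univ M) E)) (s : Sub D E) :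
  csub (model_univ M) c s =~ c[s]t.
Proof. apply cast_tot. Qed.

Lemma let1_mod (c : Tm (U (model_univ M) (ext mu A))) : (let1 c)[mod_pt]t =~ c.
Proof.
unfold let1.
eapply tot_trans; [eapply tmsub_tot; apply csub_tot|].
eapply tot_trans; [apply tot_sym, tmsub_comp|].
eapply tot_trans; [apply tmsub_eq, reframe_mod_pt|].
eapply tot_trans; [apply tmsub_comp|].
rewrite letmod_beta.
eapply tot_trans; [apply cast_sub|].
eapply tot_trans; [eapply tmsub_tot; apply csub_tot|].
eapply tot_trans; [apply tot_sym, tmsub_comp|].
eapply tot_trans; [apply tmsub_eq, unframe_frame|]. apply tmsub_id.
Qed.

End LetUnframed.

(** The two variables x, y : A of the context G.(mu | x : A).(mu | y : A), as
    terms under the lock mu, and the endpoints of the canonical map. *)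

Section Endpoints.
Context {n m : mode T} {mu : modality n m} {G : Ctx M m} (A : Ty (lock mu G)).

Definition wkA : Ty (lock mu (ext mu A)) := A[lock_sub mu (wk A)]T.
Definition vx : Tm wkA[lock_sub mu (wk wkA)]T := (var A)[lock_sub mu (wk wkA)]t.
Definition vy : Tm wkA[lock_sub mu (wk wkA)]T := var wkA.

Definition id_of_mods : Ty (ext mu wkA) :=
  Id (model_id M) (mod (model_mod M) mu vx) (mod (model_mod M) mu vy).
Definition mod_of_id : Ty (ext mu wkA) := Mod (model_mod M) mu (Id (model_id M) vx vy).

(** (mu | x, y : A) -> Id (mod x) (mod y) -> <mu | Id x y>. *)
Definition canonical_ty : Ty G :=
  Pi (model_pi M) mu A (Pi (model_pi M) mu wkA (Arr id_of_mods mod_of_id)).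

End Endpoints.

(** For a small type A, identity elimination applies to the motive
    (b : <mu | A>, p : Id (mod x) b) |-> let mod y = b in <mu | Id x y>,
    a family in the universe; at p = rfl it is given mod rfl. *)

Section Map.
Context {n m : mode T} {mu : modality n m} {G : Ctx M m} (a : Tm (U (model_univ M) (lock mu G))).
Let A := El (model_univ M) a.

Lemma El_sub2 {o} {D E H : Ctx M o} (c : Tm (U (model_univ M) E)) (s : Sub D E) (t : Sub H D) :
  (El (model_univ M) c)[s]T[t]T
  = El (model_univ M) (csub (model_univ M) (csub (model_univ M) c s) t).
Proof. unfold csub. rewrite <- !El_sub. reflexivity. Qed.

Definition code_xy : Tm (U (model_univ M) (ext mu (wkA A))) :=
  cMod (model_univ M) mu (cId (model_univ M) (cast (El_sub2 _ _ _) (vx A)) (cast (El_sub2 _ _ _) (vy A))).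

Lemma El_code_xy : El (model_univ M) code_xy = mod_of_id A.
Proof.
unfold code_xy, mod_of_id. rewrite El_cMod, El_cId. f_equal.
apply Id_tot; apply cast_tot.
Qed.

Definition mod_x : Tm (Mod (model_mod M) mu (wkA A)) := mod (model_mod M) mu (var A).

(** (x, b) |-> let mod y = b in <mu | Id x y> *)
Definition motive : Ty (ext1 (Mod (model_mod M) mu (wkA A))) :=
  El (model_univ M) (let1 (wkA A) code_xy).

Lemma motive_mod : motive[mod_pt (wkA A)]T = mod_of_id A.
Proof.
unfold motive. rewrite El_sub, <- El_code_xy. symmetry.
apply El_eq. apply tot_sym, let1_mod.
Qed.

Lemma diag_ty : wkA A = (wkA A)[lock_sub mu (sid _)]T.
Proof. rewrite lock_sub_id, tysub_id. reflexivity. Qed.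

Definition diag : Sub (ext mu A) (ext mu (wkA A)) :=
  spair mu (wkA A) (sid _) (cast diag_ty (var A)).

Lemma vx_diag : (vx A)[lock_sub mu diag]t =~ var A.
Proof.
unfold vx. eapply tot_trans; [apply tot_sym, tmsub_comp|].
rewrite <- lock_sub_comp. unfold diag. rewrite wk_spair, lock_sub_id. apply tmsub_id.
Qed.

Lemma vy_diag : (vy A)[lock_sub mu diag]t =~ var A.
Proof. eapply tot_trans; [apply var_spair|]. apply cast_tot. Qed.

Lemma mod_pt_diag : mod_pt (wkA A) ∘ diag = inst mod_x.
Proof.
apply spair_ext.
- transitivity (sid (ext mu A)); [|symmetry; apply wk1_inst].
  rewrite scomp_assoc. transitivity (wk (wkA A) ∘ diag); [|apply wk_spair].
  apply f_equal2; [apply wk1_spair1|reflexivity].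
- rewrite lock_sub_comp.
  eapply tot_trans; [apply tmsub_comp|].
  eapply tot_trans; [eapply tmsub_tot; apply var_spair|].
  eapply tot_trans; [apply cast_sub|].
  eapply tot_trans; [apply tot_sym, tmsub_comp|].
  apply tot_sym.
  eapply tot_trans; [apply var_spair|].
  eapply tot_trans; [apply cast_tot|].
  eapply tot_trans; [apply cast_sub|].
  apply tot_sym.
  unfold coe. rewrite <- lock_id_sub.
  eapply tot_trans; [apply tmsub_comp|].
  eapply tmsub_tot.
  eapply tot_trans; [apply cast_sub|].
  eapply tot_trans; [apply mod_sub|].
  apply mod_tot, vy_diag.
Qed.

Lemma base_ty : Mod (model_mod M) mu (Id (model_id M) (var A) (var A))
  = motive[wk1 (path_from (model_id M) mod_x)]T[rfl_pt (model_id M) mod_x]T.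
Proof.
rewrite <- tysub_comp. unfold rfl_pt. rewrite wk1_spair1, <- mod_pt_diag, tysub_comp, motive_mod.
unfold mod_of_id. rewrite Mod_sub, Id_sub. f_equal.
apply Id_tot; apply tot_sym; [apply vx_diag|apply vy_diag].
Qed.

Definition canonical_J : Tm motive[wk1 (path_from (model_id M) mod_x)]T :=
  J (model_id M) mod_x _
    (cast base_ty (mod (model_mod M) mu (rfl (model_id M) (var A)))).

Lemma path_mod_pt : id_of_mods A = (path_from (model_id M) mod_x)[mod_pt (wkA A)]T.
Proof.
unfold id_of_mods, path_from. rewrite Id_sub. apply Id_tot; apply tot_sym.
- eapply tot_trans; [apply tot_sym, tmsub_comp|].
  unfold mod_pt. rewrite wk1_spair1.
  unfold mod_x. apply mod_sub.
- eapply tot_trans; [apply var1_spair1|]. apply cast_tot.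
Qed.

Lemma canonical_body_ty :
  motive[wk1 (path_from (model_id M) mod_x)]T[lift1 (mod_pt (wkA A)) path_mod_pt]T
  = (mod_of_id A)[wk1 (id_of_mods A)]T.
Proof.
rewrite <- tysub_comp, wk1_lift1, tysub_comp, motive_mod. reflexivity.
Qed.

Definition canonical_fibre : Tm (Arr (id_of_mods A) (mod_of_id A)) :=
  lam (model_pi M) (mid m)
    (cast canonical_body_ty canonical_J[lift1 (mod_pt (wkA A)) path_mod_pt]t).

Definition canonical_map : Tm (canonical_ty A) :=
  lam (model_pi M) mu (lam (model_pi M) mu canonical_fibre).

Lemma rfl_diag_ty : Id (model_id M) mod_x mod_x = (id_of_mods A)[diag]T.
Proof.
unfold id_of_mods, mod_x. rewrite Id_sub. apply Id_tot; apply tot_sym.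
- eapply tot_trans; [apply mod_sub|]. apply mod_tot, vx_diag.
- eapply tot_trans; [apply mod_sub|]. apply mod_tot, vy_diag.
Qed.

Lemma canonical_map_rfl :
  (fun_apply (unlam (model_pi M) mu (unlam (model_pi M) mu canonical_map)))
    [spair1 (id_of_mods A) diag (cast rfl_diag_ty (rfl (model_id M) mod_x))]t
  =~ mod (model_mod M) mu (rfl (model_id M) (var A)).
Proof.
unfold canonical_map. rewrite !unlam_lam. unfold canonical_fibre, fun_apply.
rewrite unlam_lam.
eapply tot_trans; [apply cast_sub|].
eapply tot_trans; [apply tot_sym, tmsub_comp|].
eapply tot_trans; [apply (@tmsub_eq _ _ _ _ _ _ canonical_J _ (rfl_pt (model_id M) mod_x))|].
- apply spair_ext.
  + transitivity (inst mod_x); [|symmetry; apply wk1_spair1].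
    rewrite scomp_assoc, <- mod_pt_diag.
    transitivity (mod_pt (wkA A) ∘ wk1 (id_of_mods A)
      ∘ spair1 (id_of_mods A) diag (cast rfl_diag_ty (rfl (model_id M) mod_x))).
    * apply f_equal2; [apply wk1_lift1|reflexivity].
    * rewrite <- scomp_assoc, wk1_spair1. reflexivity.
  + rewrite lock_sub_comp.
    eapply tot_trans; [apply tmsub_comp|].
    eapply tot_trans; [eapply tmsub_tot; apply var_lift|].
    eapply tot_trans; [apply var_spair|].
    apply tot_sym.
    eapply tot_trans; [apply var_spair|].
    eapply tot_trans; [apply cast_tot|].
    apply tot_sym.
    eapply tot_trans; [apply cast_tot|].
    eapply tot_trans; [apply cast_sub|].
    apply tot_sym, cast_sub.
- unfold canonical_J. rewrite J_beta. apply cast_tot.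
Qed.

End Map.

(** The map is a family of maps Id (mod x) (mod y) -> <mu | Id x y> in the context
    G.(mu | x : A).(mu | y : A), and its invertibility is that of the family. *)
Definition canonical_map_invertible {n m} {mu : modality n m} {G : Ctx M m}
  (a : Tm (U (model_univ M) (lock mu G))) : Prop :=
  invertible (unlam (model_pi M) mu (unlam (model_pi M) mu (canonical_map a))).

End Canonical.

(** * The mode theory with two modes and one non-identity modality *)

Inductive arrow_mode : Set := mode_n | mode_m.

Inductive arrow_modality : arrow_mode -> arrow_mode -> Set :=
  | arrow_id : forall x, arrow_modality x x
  | arrow_mu : arrow_modality mode_n mode_m.

Definition arrow_comp {o n m : arrow_mode} (f : arrow_modality n m) :
  arrow_modality o n -> arrow_modality o m :=
  match f in arrow_modality n m return arrow_modality o n -> arrow_modality o m with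
  | arrow_id _ => fun g => g
  | arrow_mu => fun g =>
      match g in arrow_modality o n' return
        match n' with mode_n => arrow_modality o mode_m | mode_m => unit end
      with
      | arrow_id mode_n => arrow_mu
      | arrow_id mode_m => tt
      | arrow_mu => tt
      end
  end.

Lemma arrow_comp_idr {n m} (f : arrow_modality n m) : arrow_comp f (arrow_id n) = f.
Proof. destruct f; reflexivity. Qed.

Lemma arrow_comp_assoc {p o n m} (f : arrow_modality n m) (g : arrow_modality o n)
  (h : arrow_modality p o) : arrow_comp f (arrow_comp g h) = arrow_comp (arrow_comp f g) h.
Proof.
destruct f as [x|]; [reflexivity|].
exact (match g as g' in arrow_modality o' n' return
    match n' return arrow_modality o' n' -> Prop with
    | mode_n => fun g' => forall h : arrow_modality p o',
        arrow_comp arrow_mu (arrow_comp g' h) = arrow_comp (arrow_comp arrow_mu g') h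
    | mode_m => fun _ => True
    end g' with
  | arrow_id mode_n => fun h => eq_refl
  | arrow_id mode_m => I
  | arrow_mu => I
  end h).
Qed.

(** The only 2-cells are identities. *)
Definition arrow_theory : mode_theory.
Proof.
refine {|
  mode := arrow_mode;
  modality := arrow_modality;
  cell n m mu nu := mu = nu;
  mid := arrow_id;
  mcomp o n m := @arrow_comp o n m;
  cid n m mu := eq_refl mu;
  vcomp n m mu nu rho be al := eq_trans al be;
  hcomp o n m mu mu' nu nu' al be := f_equal2 (@arrow_comp o n m) al be;
  mcomp_idl n m mu := eq_refl mu;
  mcomp_idr n m mu := arrow_comp_idr mu;
  mcomp_assoc p o n m mu nu rho := arrow_comp_assoc mu nu rho
|}; intros; apply proof_irrelevance.
Defined.

Definition arrow_modality_mu : @modality arrow_theory mode_n mode_m := arrow_mu.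

(* Main.v *)
(** Take sets as contexts at both modes, with identity functors as locks. Types at
    mode [m] are families of sets with the usual extensional identity types. Types at
    mode [n] are families of pointed sets, the point acting as an "exception":
    booleans and identity types at [n] have an extra element, on which eliminators
    return the point of their motive. The modal type [<mu | A>] forgets the point.
    Hence [Id (mod x) (mod y)] is the proposition [x = y], whereas [<mu | Id x y>]
    is [option (x = y)], inhabited for all [x] and [y]: there is no map back once
    [A] has two distinct elements. *)

From Stdlib Require Import FunctionalExtensionality.
Require Import Defs.

Set Implicit Arguments.
Unset Strict Implicit.
Unset Printing Implicit Defensive.

(** * Pointed sets and exceptions *)

(** Primitive projections make surjective pairing definitional, and with it most
    laws of the model. *)
#[projections(primitive)]
Record dsum (X : Type) (F : X -> Type) := dpair { fst : X; snd : F fst }.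
Arguments dpair {X F} _ _.

(** At [mode_m] the point lies in [unit], so the single record [ptype] describes plain sets there
    and pointed sets at [mode_n]. *)
Definition pointing (m : arrow_mode) (X : Type) : Type :=
  match m with mode_n => X | mode_m => unit end.

Record ptype (m : arrow_mode) := Ptype { car : Type; pt : pointing m car }.
Arguments Ptype {m} _ _.

(** Carriers in [Set] keep the collection of codes small enough to be the carrier of a [ptype]. *)
Record sptype (m : arrow_mode) := Sptype { scar : Set; spt : pointing m scar }.
Arguments Sptype {m} _ _.

Definition decode {m} (c : sptype m) : ptype m := Ptype (scar c) (spt c).

Definition pi_pt {m} {X : Type} (F : X -> ptype m) : pointing m (forall x, car (F x)) :=
  match m return forall F : X -> ptype m, pointing m (forall x, car (F x)) with
  | mode_n => fun F x => pt (F x)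
  | mode_m => fun _ => tt
  end F.

Definition sum_pt {m} (X : ptype m) (F : car X -> ptype m) :
  pointing m (dsum (fun x => car (F x))) :=
  match m return forall (X : ptype m) (F : car X -> ptype m),
    pointing m (dsum (fun x => car (F x))) with
  | mode_n => fun X F => dpair (pt X) (pt (F (pt X)))
  | mode_m => fun _ _ => tt
  end X F.

(** No modality goes from [mode_m] to [mode_n], where a point would have to be invented. *)
Definition mod_pointing {n m} (mu : arrow_modality n m) {X : Type} :
  pointing n X -> pointing m X :=
  match mu in arrow_modality n m return pointing n X -> pointing m X with
  | arrow_id _ => fun x => x
  | arrow_mu => fun _ => tt
  end.

Definition lifted (m : arrow_mode) (X : Set) : Set :=
  match m with mode_n => option X | mode_m => X end.

Definition ret {m : arrow_mode} {X : Set} (x : X) : lifted m X :=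
  match m return lifted m X with mode_n => Some x | mode_m => x end.

Definition lifted_pt (m : arrow_mode) (X : Set) : pointing m (lifted m X) :=
  match m return pointing m (lifted m X) with mode_n => None | mode_m => tt end.

(** The beta laws constrain only the values at [ret x], which leaves the value at [None] free. *)
Definition lifted_elim {m} {X : Set} (P : lifted m X -> ptype m) :
  (forall x, car (P (ret x))) -> forall q, car (P q) :=
  match m return forall P : lifted m X -> ptype m,
    (forall x, car (P (ret x))) -> forall q, car (P q) with
  | mode_n => fun P h q => match q with Some x => h x | None => pt (P None) end
  | mode_m => fun P h q => h q
  end P.

Lemma lifted_elim_ret {m} {X : Set} (P : lifted m X -> ptype m)
  (h : forall x, car (P (ret x))) x : lifted_elim (P := P) h (ret x) = h x.
Proof. destruct m; reflexivity. Qed.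

(** * Contexts, types and terms *)

Definition ptype_ctxs : ctx_structure arrow_theory.
Proof.
refine {|
  Ctx := fun _ => Type;
  Sub := fun _ G D => G -> D;
  sid := fun _ G g => g;
  scomp := fun _ G D E s t g => s (t g);
  scomp_idl := fun _ _ _ _ => eq_refl;
  scomp_idr := fun _ _ _ _ => eq_refl;
  scomp_assoc := fun _ _ _ _ _ _ _ _ => eq_refl;
  emp := fun _ => unit;
  bang := fun _ _ _ => tt;
  lock := fun _ _ _ G => G;
  lock_sub := fun _ _ _ _ _ s => s;
  lock_sub_id := fun _ _ _ _ => eq_refl;
  lock_sub_comp := fun _ _ _ _ _ _ _ _ => eq_refl;
  (* Reflexivity for [lock_id] and [lock_comp] lets the [coe] maps reduce to identities, so that
     most later laws hold by conversion. *)
  lock_id := fun _ _ => eq_refl;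
  lock_comp := fun _ _ _ _ _ _ => eq_refl;
  lock_id_sub := fun _ _ _ _ => eq_refl;
  lock_comp_sub := fun _ _ _ _ _ _ _ _ => eq_refl;
  key := fun _ _ _ _ _ _ g => g;
  key_nat := fun _ _ _ _ _ _ _ _ => eq_refl;
  key_id := fun _ _ _ _ => eq_refl;
  key_vcomp := fun _ _ _ _ _ _ _ _ => eq_refl;
  key_hcomp := fun _ _ _ _ _ _ _ _ _ _ => eq_refl
|}.
intros m G s. apply functional_extensionality. intros g. destruct (s g). reflexivity.
Defined.

Definition ptype_cwf : modal_cwf arrow_theory.
Proof.
unshelve refine {|
  ctxs := ptype_ctxs;
  Ty := fun m (G : Type) => G -> ptype m;
  tysub := fun m G D A s g => A (s g);
  tysub_id := fun _ _ _ => eq_refl;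
  tysub_comp := fun _ _ _ _ _ _ _ => eq_refl;
  Tm := fun m G A => forall g, car (A g);
  tmsub := fun m G D A a s g => a (s g);
  tmsub_id := fun _ _ _ _ => eq_refl;
  tmsub_comp := fun _ _ _ _ _ _ _ _ => eq_refl;
  ext := fun n m mu G A => dsum (fun g : G => car (A g));
  wk := fun n m mu G A p => fst p;
  var := fun n m mu G A p => snd p;
  spair := fun n m mu G D A s a g => dpair (s g) (a g);
  wk_spair := fun _ _ _ _ _ _ _ _ => eq_refl;
  var_spair := fun _ _ _ _ _ _ _ _ => eq_refl
|}.
(* The two types are convertible here, so equality in the total space gives equality of terms. *)
intros n m mu G D A s a h. apply tot_eq_eq in h. rewrite h. reflexivity.
Defined.

(** * Connectives *)

Definition ptype_pi : pi_structure ptype_cwf.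
Proof.
exact (@Build_pi_structure arrow_theory ptype_cwf
  (fun n m mu (G : Type) A B g =>
    Ptype (forall a : car (A g), car (B (dpair g a))) (pi_pt (fun a => B (dpair g a))))
  (fun _ _ _ _ _ _ _ _ => eq_refl)
  (fun n m mu G A B b g a => b (dpair g a))
  (fun n m mu G A B f p => f (fst p) (snd p))
  (fun _ _ _ _ _ _ _ => eq_refl)
  (fun _ _ _ _ _ _ _ => eq_refl)
  (fun _ _ _ _ _ _ _ _ _ => eq_refl)).
Defined.

Definition ptype_mod_formation : mod_formation ptype_cwf.
Proof.
exact (@Build_mod_formation arrow_theory ptype_cwf
  (fun n m mu (G : Type) A g => Ptype (car (A g)) (mod_pointing mu (pt (A g))))
  (fun _ _ _ _ _ _ _ => eq_refl)
  (fun n m mu G A a => a)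
  (fun _ _ _ _ _ _ _ _ => eq_refl)).
Defined.

Definition ptype_mod : mod_structure ptype_cwf.
Proof.
exact (@Build_mod_structure arrow_theory ptype_cwf ptype_mod_formation
  (* A modal type keeps the carrier of [A], so [mod_var] reduces to the identity map. *)
  (fun o n m nu mu G A B b => b)
  (fun _ _ _ _ _ _ _ _ _ => eq_refl)
  (fun o n m nu mu G D A B b s b' h => tot_sym h)).
Defined.

Definition ptype_sig : sig_structure ptype_cwf.
Proof.
exact (@Build_sig_structure arrow_theory ptype_cwf
  (fun m (G : Type) A B g =>
    Ptype (dsum (fun a : car (A g) => car (B (dpair g a))))
      (sum_pt (X := A g) (fun a => B (dpair g a))))
  (fun _ _ _ _ _ _ => eq_refl)
  (fun m G A B a b g => dpair (a g) (b g))
  (fun m G A B p g => fst (p g))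
  (fun m G A B p g => snd (p g))
  (fun _ _ _ _ _ _ => eq_refl)
  (fun _ _ _ _ _ _ => eq_refl)
  (fun _ _ _ _ _ => eq_refl)
  (fun _ _ _ _ _ _ _ => eq_refl)
  (fun _ _ _ _ _ _ _ => eq_refl)).
Defined.

Definition ptype_bool : bool_structure ptype_cwf.
Proof.
unshelve refine (@Build_bool_structure arrow_theory ptype_cwf
  (fun m (G : Type) g => Ptype (lifted m bool) (lifted_pt m bool))
  (fun _ _ _ _ => eq_refl)
  (fun m G g => ret true)
  (fun m G g => ret false)
  (fun _ _ _ _ => eq_refl)
  (fun _ _ _ _ => eq_refl)
  (fun m G B b c p => lifted_elim (P := fun q => B (dpair (fst p) q))
     (fun x : bool => if x return car (B (dpair (fst p) (ret x)))
       then b (fst p) else c (fst p)) (snd p))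
  _ _ _).
- intros m G B b c. apply functional_extensionality_dep. intros g.
  apply (lifted_elim_ret (P := fun q => B (dpair g q))).
- intros m G B b c. apply functional_extensionality_dep. intros g.
  apply (lifted_elim_ret (P := fun q => B (dpair g q))).
- intros m G D B b c s B' b' c' hb hc.
  apply tot_eq_eq in hb, hc. subst b' c'. reflexivity.
Defined.

(** * Identity types *)

Definition ptype_id_formation : id_formation ptype_cwf.
Proof.
exact (@Build_id_formation arrow_theory ptype_cwf
  (fun m (G : Type) A a b g =>
    Ptype (lifted m (a g = b g)) (lifted_pt m (a g = b g)))
  (fun _ _ _ _ _ _ _ => eq_refl)
  (fun m G A a g => ret eq_refl)
  (fun _ _ _ _ _ _ => eq_refl)).
Defined.

Section PathInduction.
Context {m : arrow_mode} {G : Type} {A : G -> ptype m} (a : forall g, car (A g)).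

Let paths : Type := @ext1 _ ptype_cwf m _ (path_from ptype_id_formation (G := G) a).

Definition refl_path (g : G) : paths := dpair (dpair g (a g)) (ret eq_refl).

(** The cast along the opaque [path_from_inst] does not reduce, but its two ends are convertible,
    which makes it an identity. *)
Lemma rfl_pt_refl_path : rfl_pt ptype_id_formation (G := G) a = refl_path.
Proof.
apply functional_extensionality. intros g. unfold rfl_pt, refl_path.
rewrite (tot_eq_eq (cast_tot (path_from_inst ptype_id_formation (G := G) a)
  (rfl ptype_id_formation (G := G) a))).
reflexivity.
Qed.

(** [rfl_pt] equals [refl_path] only propositionally, so the eliminator takes an
    arbitrary [r] equal to [refl_path]; its laws then follow by path induction
    on this equality. *)
Definition path_ind (r : G -> paths) (e : r = refl_path) (B : paths -> ptype m)
  (b : forall g, car (B (r g))) (p : paths) : car (B p) :=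
  lifted_elim (P := fun q => B (dpair (fst p) q))
    (fun h : a (fst (fst p)) = snd (fst p) =>
      match h as h0 in _ = x return car (B (dpair (dpair (fst (fst p)) x) (ret h0))) with
      | eq_refl =>
          match e in _ = r0 return car (B (r0 (fst (fst p)))) with
          | eq_refl => b (fst (fst p))
          end
      end)
    (snd p).

Lemma path_ind_refl (r : G -> paths) (e : r = refl_path) (B : paths -> ptype m)
  (b : forall g, car (B (r g))) g : path_ind e b (r g) = b g.
Proof.
subst r. unfold path_ind.
apply (lifted_elim_ret (P := fun q => B (dpair (dpair g (a g)) q))).
Qed.

End PathInduction.

(** The map [f] stands for [path_lift], which does not reduce to its explicit form. Substituting the
    equations for [f], [r] and [r'] makes both sides convertible. *)
Lemma path_ind_sub {m} {G D : Type} {A : D -> ptype m} (a : forall g, car (A g)) (s : G -> D)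
  (r : D -> _) (e : r = refl_path a) (r' : G -> _) (e' : r' = refl_path (fun g => a (s g)))
  (f : @ext1 _ ptype_cwf m _ (path_from ptype_id_formation (G := G) (fun g => a (s g))) ->
       @ext1 _ ptype_cwf m _ (path_from ptype_id_formation (G := D) a))
  (ef : f = fun p => dpair (dpair (s (fst (fst p))) (snd (fst p))) (snd p))
  (B : _ -> ptype m) (b : forall g, car (B (r g))) (b' : forall g, car (B (f (r' g)))) :
  tot_eq (F := fun X : G -> ptype m => forall g, car (X g))
    (a := fun g => B (f (r' g))) (b := fun g => B (r (s g))) b' (fun g => b (s g)) ->
  forall p, path_ind e b (f p) = path_ind e' (B := fun p => B (f p)) b' p.
Proof.
subst f r r'. intros h p. apply tot_eq_eq in h. subst b'. reflexivity.
Qed.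

Definition ptype_id : id_structure ptype_cwf.
Proof.
unshelve refine (@Build_id_structure arrow_theory ptype_cwf ptype_id_formation
  (fun m G A a B b => path_ind (rfl_pt_refl_path a) b) _ _).
- intros m G A a B b. apply functional_extensionality_dep. intros g.
  apply path_ind_refl.
- intros m G D A a B b s B' b' h.
  assert (E : path_lift ptype_id_formation a s
    = fun p => dpair (dpair (s (fst (fst p))) (snd (fst p))) (snd p)).
  { apply (@spair_ext _ ptype_cwf _ _ (mid m) _ _ (lock1 (path_from ptype_id_formation a)));
      [reflexivity|].
    apply (var_lift (C := ptype_cwf)). }
  apply (f_equal (existT _ B')). apply functional_extensionality_dep. intros p.
  exact (@path_ind_sub m G D A a s _ (rfl_pt_refl_path a) _ (rfl_pt_refl_path a[s]t) _ E
    B b b' h p).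
Defined.

(** * The universe *)

Definition ptype_univ_formation : univ_formation ptype_cwf.
Proof.
exact (@Build_univ_formation arrow_theory ptype_cwf
  (fun m (G : Type) g =>
    Ptype (sptype m)
      (match m return pointing m (sptype m) with
       (* The universe at [mode_n] must itself be pointed; the code of the one-element set serves as
          its point. *)
       | mode_n => Sptype (m := mode_n) unit tt
       | mode_m => tt
       end))
  (fun _ _ _ _ => eq_refl)
  (fun m G c g => decode (c g))
  (fun _ _ _ _ _ => eq_refl)).
Defined.

Definition ptype_univ :
  univ_structure ptype_pi ptype_mod ptype_sig ptype_bool ptype_id.
Proof.
exact (@Build_univ_structure arrow_theory ptype_cwf
  ptype_pi ptype_mod ptype_sig ptype_bool ptype_id ptype_univ_formation
  (fun n m mu (G : Type) a b g =>
    Sptype (forall x : scar (a g), scar (b (dpair g x)))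
      (pi_pt (fun x => decode (b (dpair g x)))))
  (fun n m mu G a g => Sptype (scar (a g)) (mod_pointing mu (spt (a g))))
  (fun m (G : Type) a b g =>
    Sptype (dsum (fun x : scar (a g) => scar (b (dpair g x))))
      (sum_pt (X := decode (a g)) (fun x => decode (b (dpair g x)))))
  (fun m G g => Sptype (lifted m bool) (lifted_pt m bool))
  (fun m G a x y g => Sptype (lifted m (x g = y g)) (lifted_pt m (x g = y g)))
  (fun _ _ _ _ _ _ => eq_refl)
  (fun _ _ _ _ _ => eq_refl)
  (fun _ _ _ _ => eq_refl)
  (fun _ _ => eq_refl)
  (fun _ _ _ _ _ => eq_refl)
  (fun _ _ _ _ _ _ _ _ => eq_refl)
  (fun _ _ _ _ _ _ _ => eq_refl)
  (fun _ _ _ _ _ _ => eq_refl)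
  (fun _ _ _ _ => eq_refl)
  (fun _ _ _ _ _ _ _ => eq_refl)).
Defined.

Definition ptype_model : MTT_model arrow_theory :=
  {| model_sig := ptype_sig; model_bool := ptype_bool; model_univ := ptype_univ |}.

(** * Failure of invertibility *)

Theorem theorem7p1 :
  exists (M : MTT_model arrow_theory) (G : Ctx M mode_m)
    (A : Tm (U (model_univ M) (lock arrow_modality_mu G))),
    ~ canonical_map_invertible M A.
Proof.
exists ptype_model, unit, (fun _ => Sptype (m := mode_n) bool true).
intros [g _].
(* At [x = true] and [y = false] the exception [None] inhabits the modal type, and the inverse sends
   it to a proof of [true = false]. *)
discriminate (g (dpair (dpair tt true) false) None : true = false).
Qed.
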